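(* For all $n\geq 0$, the number of desarrangements of length $n$ avoiding both $123$ and $312$ is \[ d_n(123,312)=\left\lceil \frac{(n-1)^2}{4}\right\rceil . \]
   Context: Permutations are in one-line notation; $\mathfrak{S}_0$ consists of the empty permutation, which is considered a desarrangement. An index $i\in[n-1]$ is a descent of $\pi\in\mathfrak{S}_n$ if $\pi_i>\pi_{i+1}$; $i\in[n]$ is an ascent if it is not a descent (so $n$ is always an ascent). A desarrangement is a permutation whose first ascent is even. $d_n(\Pi)$ is the number of desarrangements in $\mathfrak{S}_n$ avoiding every pattern in $\Pi$ ($\pi$ avoids $\sigma$ if no subsequence of $\pi$ has the same relative order as $\sigma$). *)

(* Defs.v *)
From mathcomp Require Import all_boot all_order all_algebra all_fingroup.

Set Implicit Arguments.
Unset Strict Implicit.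
Unset Printing Implicit Defensive.

Definition one_line n (p : 'S_n) : seq nat := [seq (p i).+1 | i <- enum 'I_n].

(* Positions in words are 1-based: the letter w_i is [nth 0 w i.-1]. *)
Definition is_descent (w : seq nat) (i : nat) : bool :=
  (0 < i < size w) && (nth 0 w i.-1 > nth 0 w i).

Definition is_ascent (w : seq nat) (i : nat) : bool :=
  (0 < i <= size w) && ~~ is_descent w i.

(* A nonempty word has an ascent (its last position); the default value 0 is
   only taken on the empty word. *)
Definition first_ascent (w : seq nat) : nat :=
  head 0 [seq i <- iota 1 (size w) | is_ascent w i].

Definition desarrangement n (p : 'S_n) : bool :=
  (n == 0) || ~~ odd (first_ascent (one_line p)).

Definition order_isomorphic (u v : seq nat) : bool :=
  (size u == size v) &&
  [forall i : 'I_(size u), forall j : 'I_(size u),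
     (nth 0 u i < nth 0 u j) == (nth 0 v i < nth 0 v j)].

(* The subsequences of a word of length n are its masks by n bits.  The pattern
   [sigma] is a permutation given by its one-line notation. *)
Definition avoids n (p : 'S_n) (sigma : seq nat) : bool :=
  ~~ [exists m : n.-tuple bool, order_isomorphic (mask m (one_line p)) sigma].

Definition num_desarrangements (n : nat) (Pi : seq (seq nat)) : nat :=
  #|[set p : 'S_n | desarrangement p && all (avoids p) Pi]|.

(* Main.v *)
(** A permutation of [n] avoiding 123 and 312 with first letter a and first
    ascent j < n must be the word
      a (a-1) ... (a-j+1) | n (n-1) ... (a+1) | (a-j) ... 1,
    with 1 <= j <= a < n; the only other one is the decreasing permutation,
    whose first ascent is n.  Counting even first ascents gives
    sum_(a < n) floor (a/2), plus 1 if n is even. *)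
Require Import Defs.
From mathcomp Require Import all_boot all_order all_algebra all_fingroup.
From mathcomp Require Import zify lra.

Set Implicit Arguments.
Unset Strict Implicit.
Unset Printing Implicit Defensive.

Import GRing.Theory.
Local Open Scope nat_scope.

(** * Pattern avoidance in terms of positions *)

Lemma size_one_line n (p : 'S_n) : size (one_line p) = n.
Proof. by rewrite size_map size_enum_ord. Qed.

Lemma nth_one_line n (p : 'S_n) (i : 'I_n) : nth 0 (one_line p) i = (p i).+1.
Proof. by rewrite (nth_map i) ?size_enum_ord // nth_ord_enum. Qed.

(** Bit masks correspond to increasing lists of positions: the mask of [s] is membership in [s]. *)
Lemma avoidsP n (p : 'S_n) (sigma : seq nat) :
  reflect (forall s, sorted ltn s -> all (fun i => i < n) s ->
             ~~ order_isomorphic [seq nth 0 (one_line p) i | i <- s] sigma)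
          (avoids p sigma).
Proof.
have maskE m : mask m (one_line p)
    = [seq nth 0 (one_line p) i | i <- mask m (iota 0 n)].
  by rewrite map_mask map_nth_iota0 ?size_one_line // -{2}(size_one_line p) take_size.
apply: (iffP existsPn) => [av s s_sorted s_lt | av m].
  pose m := [tuple (val i \in s) | i < n].
  have := av m; rewrite maskE.
  suff -> : mask m (iota 0 n) = s by [].
  have -> : tval m = [seq i \in s | i <- iota 0 n].
    by rewrite /= -val_enum_ord -map_comp.
  rewrite -filter_mask.
  apply: (irr_sorted_eq ltn_trans ltnn) => //.
    by apply: sorted_filter; [exact: ltn_trans | exact: iota_ltn_sorted].
  move=> i; rewrite mem_filter mem_iota /= add0n.
  by case: (boolP (i \in s)) => //= /(allP s_lt).
rewrite maskE; apply: av.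
  apply: (subseq_sorted ltn_trans (mask_subseq _ _)); exact: iota_ltn_sorted.
by apply/allP => i /mem_mask; rewrite mem_iota.
Qed.

Lemma order_isomorphic3 (a b c x y z : nat) :
  order_isomorphic [:: a; b; c] [:: x; y; z] =
  [&& (a < b) == (x < y), (b < a) == (y < x), (a < c) == (x < z),
      (c < a) == (z < x), (b < c) == (y < z) & (c < b) == (z < y)].
Proof.
rewrite /order_isomorphic /=; apply/forallP/idP => [H | H i].
  have K i j (hi : i < 3) (hj : j < 3) := forallP (H (Ordinal hi)) (Ordinal hj).
  by rewrite (K 0 1) // (K 1 0) // (K 0 2) // (K 2 0) // (K 1 2) // (K 2 1).
apply/forallP => j; case/and5P: H => h1 h2 h3 h4 /andP[h5 h6].
by case: i j => [[|[|[|//]]] hi] [[|[|[|//]]] hj] /=; rewrite ?ltnn.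
Qed.

Lemma avoids3P n (p : 'S_n) (x y z : nat) :
  reflect (forall i j k : 'I_n, i < j -> j < k ->
             ~~ order_isomorphic [:: p i : nat; p j : nat; p k : nat] [:: x; y; z])
          (avoids p [:: x; y; z]).
Proof.
have shift (a b c : nat) : order_isomorphic [:: a.+1; b.+1; c.+1] [:: x; y; z]
    = order_isomorphic [:: a; b; c] [:: x; y; z].
  by rewrite !order_isomorphic3.
apply: (iffP (avoidsP p _)) => [av i j k ij jk | av s].
  have := av [:: val i; val j; val k]; rewrite /= !nth_one_line shift; apply.
    by rewrite ij jk.
  by rewrite !ltn_ord.
case: s => [|i [|j [|k [|l s]]]] //= /and3P[ij jk _] /and4P[hi hj hk _].
rewrite (nth_one_line p (Ordinal hi)) (nth_one_line p (Ordinal hj)).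
by rewrite (nth_one_line p (Ordinal hk)) shift; apply: av.
Qed.

Lemma avoids123P n (p : 'S_n) :
  reflect (forall i j k : 'I_n, i < j -> j < k -> p i < p j -> p j < p k -> False)
          (avoids p [:: 1; 2; 3]).
Proof.
apply: (iffP (avoids3P p _ _ _)) => av i j k ij jk; move: (av i j k ij jk).
  by rewrite order_isomorphic3; lia.
by rewrite order_isomorphic3 => H; apply/negP; lia.
Qed.

Lemma avoids312P n (p : 'S_n) :
  reflect (forall i j k : 'I_n, i < j -> j < k -> p j < p k -> p k < p i -> False)
          (avoids p [:: 3; 1; 2]).
Proof.
apply: (iffP (avoids3P p _ _ _)) => av i j k ij jk; move: (av i j k ij jk).
  by rewrite order_isomorphic3; lia.
by rewrite order_isomorphic3 => H; apply/negP; lia.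
Qed.

(** * First ascents *)

Lemma first_ascent_eq (w : seq nat) (j : nat) :
  is_ascent w j -> (forall i, 0 < i < j -> is_descent w i) ->
  first_ascent w = j.
Proof.
move=> asc desc; have /andP[/andP[j0 jw] _] := asc.
rewrite /first_ascent.
have -> : size w = j.-1 + (size w - j).+1 by lia.
rewrite iotaD filter_cat (_ : 1 + j.-1 = j) /=; last by lia.
rewrite asc (_ : filter _ _ = [::]) //.
apply/eqP; rewrite -(negbK (_ == _)) -has_filter; apply/hasPn => i.
rewrite mem_iota => hi; rewrite /is_ascent desc ?andbF //; lia.
Qed.

Lemma first_ascent_spec (w : seq nat) : 0 < size w ->
  is_ascent w (first_ascent w) /\
  (forall i, 0 < i < first_ascent w -> is_descent w i).
Proof.
move=> w0; have ex : exists j, is_ascent w j.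
  by exists (size w); rewrite /is_ascent /is_descent w0 leqnn ltnn andbF.
case: (ex_minnP ex) => j asc jmin.
have desc i : 0 < i < j -> is_descent w i.
  move=> hi; apply/negPn/negP => nd; have /andP[hj _] := asc.
  have : j <= i by apply: jmin; rewrite /is_ascent nd andbT; lia.
  lia.
by rewrite (first_ascent_eq asc desc).
Qed.

(** * The block words *)

(* With letters and positions counted from 0, this is the word
   (j+k-1) ... k | (n-1) ... (j+k) | (k-1) ... 0. *)
Definition blocks (n j k i : nat) : nat :=
  if i < j then j + k - i.+1 else if i < n - k then n + j - i.+1 else n - i.+1.

(** If [j + k = n], the middle block is empty and the word is decreasing whatever [k] is; only
    [k = 0] is kept, so that [j] is the first ascent and parameters are unique. *)
Definition admissible (n j k : nat) : bool :=
  (0 < j) && ((j + k < n) || (j == n) && (k == 0)).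

Ltac split_ifs := repeat (case: ifPn => ?); lia.

Lemma blocks_lt n j k i : admissible n j k -> i < n -> blocks n j k i < n.
Proof. rewrite /admissible /blocks; split_ifs. Qed.

Lemma blocks_inj n j k i i' : admissible n j k -> i < n -> i' < n ->
  blocks n j k i = blocks n j k i' -> i = i'.
Proof. rewrite /admissible /blocks; split_ifs. Qed.

Definition is_blocks n (j k : nat) (p : 'S_n) : bool :=
  [forall i, p i == blocks n j k i :> nat].

Lemma is_blocksP n j k (p : 'S_n) :
  reflect (forall i, p i = blocks n j k i :> nat) (is_blocks j k p).
Proof. exact: 'forall_eqP. Qed.

Definition block_perm n (j k : nat) : 'S_n := odflt 1%g [pick p | is_blocks j k p].

Lemma block_permE n j k (i : 'I_n) : admissible n j k ->
  block_perm n j k i = blocks n j k i :> nat.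
Proof.
move=> adm; rewrite /block_perm; case: pickP => [p /is_blocksP -> // | none].
pose f (i : 'I_n) : 'I_n := Ordinal (blocks_lt adm (ltn_ord i)).
have f_inj : injective f.
  move=> x y [] /(blocks_inj adm (ltn_ord x) (ltn_ord y)); exact: val_inj.
have /is_blocksP[] := negbT (none (perm f_inj)).
by move=> x; rewrite permE.
Qed.

Lemma block_perm_uniq n j k (p : 'S_n) : admissible n j k ->
  (forall i, p i = blocks n j k i :> nat) -> p = block_perm n j k.
Proof. by move=> adm pE; apply/permP => i; apply: val_inj; rewrite /= pE block_permE. Qed.

(** An increasing pair must go from the first block to the middle one, so no three letters
    increase. *)
Lemma block_perm_avoids123 n j k : admissible n j k ->
  avoids (block_perm n j k) [:: 1; 2; 3].
Proof.
move=> adm; apply/avoids123P => x y z xy yz; rewrite !block_permE //.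
move: adm (ltn_ord x) (ltn_ord y) (ltn_ord z); rewrite /admissible /blocks; split_ifs.
Qed.

(** The 12 of a 312 would go from the first block to the middle one; any earlier letter is then in
    the first block, hence too small to be the 3. *)
Lemma block_perm_avoids312 n j k : admissible n j k ->
  avoids (block_perm n j k) [:: 3; 1; 2].
Proof.
move=> adm; apply/avoids312P => x y z xy yz; rewrite !block_permE //.
move: adm (ltn_ord x) (ltn_ord y) (ltn_ord z); rewrite /admissible /blocks; split_ifs.
Qed.

Lemma first_ascent_block_perm n j k : admissible n j k ->
  first_ascent (one_line (block_perm n j k)) = j.
Proof.
move=> adm; have nthE i : i < n ->
    nth 0 (one_line (block_perm n j k)) i = (blocks n j k i).+1.
  by move=> hi; rewrite (nth_one_line _ (Ordinal hi)) block_permE.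
have descE i : is_descent (one_line (block_perm n j k)) i
    = (0 < i < n) && (blocks n j k i < blocks n j k i.-1).
  rewrite /is_descent size_one_line; case: (boolP (0 < i < n)) => //= hi.
  by rewrite !nthE //; lia.
move: adm; rewrite /admissible => adm.
apply: first_ascent_eq => [|i hi].
  rewrite /is_ascent size_one_line descE /blocks; split_ifs.
rewrite descE /blocks; split_ifs.
Qed.

(** The first ascent recovers [j], and the first letter [j + k - 1] then recovers [k]. *)
Lemma block_perm_inj n j k j' k' : admissible n j k -> admissible n j' k' ->
  block_perm n j k = block_perm n j' k' -> j = j' /\ k = k'.
Proof.
move=> adm adm' E.
have jE : j = j' by rewrite -(first_ascent_block_perm adm) E first_ascent_block_perm.
split=> //; subst j'; have n0 : 0 < n by move: adm; rewrite /admissible; lia.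
have := block_permE (Ordinal n0) adm; rewrite E block_permE //.
by move: adm adm'; rewrite /admissible /blocks /=; split_ifs.
Qed.

(* The first ascent j and the first letter determine the word from left to
   right: whenever the next letter is not the one predicted by [blocks], the
   predicted letter occurs later and completes a 312 (or, at position j, a 123). *)
Lemma avoids_block_perm n (p : 'S_n) : 0 < n ->
  avoids p [:: 1; 2; 3] -> avoids p [:: 3; 1; 2] ->
  exists j k, admissible n j k /\ p = block_perm n j k.
Proof.
case: n p => // m p _ /avoids123P av123 /avoids312P av312.
have [] := @first_ascent_spec (one_line p); first by rewrite size_one_line.
set j := first_ascent _ => asc desc.
have nthE i : i <= m -> nth 0 (one_line p) i = (p (inord i)).+1.
  by move=> hi; rewrite -nth_one_line inordK.
have /andP[/andP[j0 jm] nd] := asc; rewrite size_one_line in jm.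
have down i : i.+1 < j -> p (inord i.+1) < p (inord i).
  move=> hi; have /desc/andP[_ /=] : 0 < i.+1 < j by [].
  by rewrite !nthE; lia.
have up : j <= m -> p (inord j.-1) < p (inord j).
  move=> hj; move: nd; rewrite /is_descent size_one_line !nthE; [|lia..].
  have : p (inord j.-1) <> p (inord j) :> nat.
    move=> /val_inj/perm_inj/(congr1 val); rewrite /= !inordK; lia.
  lia.
(* At [i = j - 1] this gives [j <= p ord0 + 1], so the subtraction defining [k] does not
   truncate. *)
have low i : i < j -> p (inord i) + i <= p ord0.
  elim: i => [_|i IH hi].
    by rewrite addn0 (_ : inord 0 = ord0) //; apply: val_inj; rewrite /= inordK.
  have := IH (ltnW hi); have := down i hi; lia.
have hpj := low j.-1; have p0m := ltn_ord (p ord0).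
pose k := (p ord0).+1 - j.
have adm : admissible m.+1 j k.
  rewrite /admissible; suff : j <= m -> p ord0 < m by rewrite /k; lia.
  (* If the first letter were maximal, it would form a 312 with positions [j - 1] and [j], or for
     [j = 1] be exceeded by the next letter. *)
  move=> hj; have pjm := ltn_ord (p (inord j)).
  case: (ltnP (p ord0) m) => // p0; have := up hj.
  have [j1|j1] := eqVneq j 1.
    rewrite j1 /= (_ : inord 0 = ord0); last by apply: val_inj; rewrite /= inordK.
    by rewrite j1 in pjm; lia.
  have neq : p (inord j) <> p ord0 :> nat.
    move=> /val_inj/perm_inj/(congr1 val); rewrite /= inordK; lia.
  move=> lt; case: (av312 ord0 (inord j.-1) (inord j)) => //=; rewrite ?inordK; lia.
exists j, k; split=> //; apply: block_perm_uniq => // i0.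
case: i0 => i; elim/ltn_ind: i => -[|i] IH hi.
  rewrite (_ : Ordinal hi = ord0); last exact: val_inj.
  rewrite /blocks /= j0 /k; lia.
have hi' : i < m.+1 by apply: ltnW.
have pi := IH i (ltnSn i) hi'.
pose q := block_perm m.+1 j k.
(* [x] is where [p] has the predicted letter, [y] where the block word has the actual one; by
   induction both lie beyond [i]. *)
pose x := p^-1%g (q (Ordinal hi)); pose y := q^-1%g (p (Ordinal hi)).
have px : p x = blocks m.+1 j k i.+1 :> nat by rewrite permKV block_permE.
have py : p (Ordinal hi) = blocks m.+1 j k y :> nat by rewrite -block_permE // permKV.
have xi : i < x.
  rewrite ltnNge; apply/negP => le; have := IH x le (ltn_ord x).
  rewrite (_ : Ordinal _ = x); last exact: val_inj.
  rewrite px => /(blocks_inj adm hi (ltn_ord x)); lia.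
have yi : i < y.
  rewrite ltnNge; apply/negP => le; have := IH y le (ltn_ord y).
  rewrite -py (_ : Ordinal (ltn_ord y) = y); last exact: val_inj.
  move=> /val_inj/perm_inj/(congr1 val) /=; lia.
have [xE|xE] := eqVneq (x : nat) i.+1.
  by rewrite -px; congr (nat_of_ord (p _)); apply: val_inj.
have [yE|yE] := eqVneq (y : nat) i.+1; first by rewrite py yE.
have hio : Ordinal hi = inord i.+1 by apply: val_inj; rewrite /= inordK.
have hio' : Ordinal hi' = inord i by apply: val_inj; rewrite /= inordK.
have hx := ltn_ord x; have hy := ltn_ord y.
exfalso.
(* The actual letter is below the predicted one: by [dn] inside the first block, and afterwards
   because the rest of the block word decreases. *)
have h312 := av312 (Ordinal hi') (Ordinal hi) x (ltnSn i).
have h123 := av123 (Ordinal hi') (Ordinal hi) x (ltnSn i).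
have dn := down i.
rewrite -hio -hio' in dn.
have uj : i.+1 = j -> p (Ordinal hi') < p (Ordinal hi).
  by move=> ij; move: up; rewrite -ij /= -hio -hio'; apply; lia.
move: h312 h123 dn uj adm; rewrite /= in px py pi *.
rewrite px py pi /admissible /blocks; clear - xi yi xE yE hx hy; split_ifs.
Qed.

(* Pairs (a, h): for a < n the first letter is a (counted from 1) and the first
   ascent is 2h+2; a = n encodes the decreasing permutation. *)
Definition ascent_of (n a h : nat) : nat := if a < n then h.*2.+2 else n.

Definition num_ascents (n a : nat) : nat := if a < n then a./2 else ~~ odd n.

Lemma num_desarrangements_sum n : 0 < n ->
  num_desarrangements n [:: [:: 1; 2; 3]; [:: 3; 1; 2]]
  = \sum_(a < n) a./2 + ~~ odd n.
Proof.
move=> n0.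
pose D := [set u : 'I_n.+1 * 'I_n.+1 | u.2 < num_ascents n u.1].
pose f (u : 'I_n.+1 * 'I_n.+1) :=
  (* Counted from 1 the first letter is [a = j + k], whence [k = a - j]. *)
  block_perm n (ascent_of n u.1 u.2) (u.1 - ascent_of n u.1 u.2).
have admD u : u \in D -> admissible n (ascent_of n u.1 u.2) (u.1 - ascent_of n u.1 u.2).
  case: u => a h; have := ltn_ord a.
  rewrite inE /= /num_ascents /ascent_of /admissible.
  by case: ifP; lia.
have -> : num_desarrangements n [:: [:: 1; 2; 3]; [:: 3; 1; 2]] = #|f @: D|.
  apply: eq_card => p; rewrite inE /= andbT.
  apply/idP/imsetP => [/and3P[des av1 av2] | [u uD ->]].
    have [j [k [adm pE]]] := avoids_block_perm n0 av1 av2.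
    move: des; rewrite /desarrangement pE first_ascent_block_perm // => des.
    move: adm (adm); rewrite {1}/admissible => adm adm'.
    have ha : j + k < n.+1 by lia.
    have hh : (if j + k < n then j./2.-1 else 0) < n.+1 by case: ifP; lia.
    have jE : ascent_of n (j + k) (if j + k < n then j./2.-1 else 0) = j.
      by rewrite /ascent_of; case: ifPn => lt; rewrite ?lt; lia.
    exists (Ordinal ha, Ordinal hh); last by rewrite /f /= jE addKn.
    by rewrite inE /= /num_ascents; case: ifPn => lt; lia.
  have adm := admD u uD.
  rewrite block_perm_avoids123 // block_perm_avoids312 // !andbT.
  rewrite /desarrangement first_ascent_block_perm //.
  case: u uD {adm} => a h; rewrite inE /= /num_ascents /ascent_of.
  case: ifP => _; last lia.
  by rewrite /= odd_double orbT.
rewrite card_in_imset => [|[a h] [a' h'] uD uD' /block_perm_inj].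
  rewrite -sum1_card.
  rewrite (eq_bigl (fun u : 'I_n.+1 * 'I_n.+1 => true && (u.2 < num_ascents n u.1)));
    last by move=> u; rewrite inE.
  rewrite -(pair_big_dep xpredT (fun a h : 'I_n.+1 => h < num_ascents n a)
              (fun _ _ => 1)) /=.
  rewrite (eq_bigr (fun a : 'I_n.+1 => num_ascents n a)) => [|a _].
    rewrite big_ord_recr /= /num_ascents ltnn; congr (_ + _).
    by apply: eq_bigr => a _; rewrite ltn_ord.
  (* The range of [h] is wide enough, since [num_ascents n a <= n + 1]. *)
  rewrite -(big_ord_widen n.+1 (fun=> 1)) ?sum1_card ?card_ord //.
  by have := ltn_ord a; rewrite /num_ascents; case: ifP; lia.
move=> /(_ (admD _ uD) (admD _ uD')).
have := ltn_ord a; have := ltn_ord a'.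
move: uD uD'; rewrite !inE /num_ascents /ascent_of /= => uD uD' lt' lt E.
have [aE hE] : a = a' :> nat /\ h = h' :> nat.
  by move: uD uD' E; case: ifPn => ?; case: ifPn => ?; lia.
by congr (_, _); apply: val_inj.
Qed.

(** * The empty case and the closed form *)

Lemma num_desarrangements0 :
  num_desarrangements 0 [:: [:: 1; 2; 3]; [:: 3; 1; 2]] = 1.
Proof.
rewrite /num_desarrangements -[RHS](card_Sn 0) -cardsT.
congr #|pred_of_set _|; apply/setP => p; rewrite !inE /desarrangement /= andbT.
by apply/andP; split; [apply/avoids123P | apply/avoids312P] => -[].
Qed.

(** The terms [2s] and [2s + 1] both contribute [s], so the sum is [t(t - 1)]; adding [t] avoids
    subtraction. *)
Lemma sum_half_double t : \sum_(a < t.*2) a./2 + t = t ^ 2.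
Proof.
elim: t => [|t IH]; first by rewrite big_ord0.
rewrite doubleS !big_ord_recr /= uphalf_double doubleK.
rewrite IH -!mulnn; nia.
Qed.

Theorem theorem3p21 (n : nat) :
  ((num_desarrangements n [:: [:: 1; 2; 3]; [:: 3; 1; 2]]%N)%:Z
   = Num.ceil ((n%:Q - 1) ^+ 2 / 4))%R.
Proof.
apply/esym/Num.Theory.ceil_def; rewrite rmorphB /= -!pmulrn.
have [-> | n0] := posnP n; first by rewrite num_desarrangements0; lra.
rewrite num_desarrangements_sum //.
have := sum_half_double n./2; have := odd_double_half n.
set t := n./2; case: (odd n) => /= nE tE.
  (* For [n = 2t + 1] the last term is [t], and [(n - 1)^2 / 4] is exactly [t^2]. *)
  have -> : \sum_(a < n) a./2 + 0 = t * t.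
    by rewrite -nE add1n big_ord_recr /= doubleK tE addn0 mulnn.
  have -> : (n%:R = 2 * t%:R + 1 :> rat)%R by rewrite -nE -muln2; lra.
  rewrite natrM; set T : rat := (t%:R)%R; apply/andP; split; lra.
(* For [n = 2t] the quotient is [t^2 - t + 1/4], which rounds up to this value. *)
have -> : ((\sum_(a < n) a./2 + 1)%:R = t%:R ^+ 2 - t%:R + 1 :> rat)%R.
  by rewrite -natrX -tE -nE add0n !natrD; lra.
have -> : (n%:R = 2 * t%:R :> rat)%R by rewrite -nE -muln2; lra.
set T : rat := (t%:R)%R; apply/andP; split; lra.
Qed.
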